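(* Let $(M,c,\nabla)$ be an $n$-dimensional $F$-manifold with compatible flat connection. Let $(X_{(1,0)},\dots,X_{(n,0)})$ be a (local) basis of flat vector fields, and for $p=1,\dots,n$ and $\alpha\ge 1$ let $X_{(p,\alpha)}$ be vector fields satisfying the recursive relations $$\nabla_j X^i_{(p,\alpha)}=c^i_{jk}X^k_{(p,\alpha-1)} .$$ Then the flows of the principal hierarchy $$u^i_{t_{(p,\alpha)}}=c^i_{jk}X^j_{(p,\alpha)}u^k_x,\qquad i=1,\dots,n,\quad p=1,\dots,n,\quad \alpha\ge 0,$$ pairwise commute.
   Context: Sum over repeated indices is understood. An $F$-manifold with compatible flat connection is a smooth manifold $M$ endowed with a commutative associative product $\circ$ on vector fields given by a $(1,2)$-tensor field $c$, $(X\circ Y)^i=c^i_{jk}X^jY^k$, and with a flat torsionless connection $\nabla$ such that $\nabla_l c^i_{jk}=\nabla_j c^i_{lk}$, i.e. $(\nabla_Xc)(Y,Z)=(\nabla_Yc)(X,Z)$ for all vector fields $X,Y,Z$. (By a theorem of Hertling, these data imply the Hertling–Manin condition: $[X\circ Y,Z\circ W]-[X\circ Y,Z]\circ W-[X\circ Y,W]\circ Z-X\circ[Y,Z\circ W]+X\circ[Y,Z]\circ W+X\circ[Y,W]\circ Z-Y\circ[X,Z\circ W]+Y\circ[X,Z]\circ W+Y\circ[X,W]\circ Z=0$ for all vector fields $X,Y,Z,W$.) A vector field $X$ is flat if $\nabla X=0$. $(u^1,\dots,u^n)$ are local coordinates on $M$. Two systems of hydrodynamic type $u^i_t=V^i_j(u)u^j_x$,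 $u^i_\tau=W^i_j(u)u^j_x$ commute if $\partial_\tau\partial_t u^i=\partial_t\partial_\tau u^i$ for all $i$, where both sides are computed by the chain rule from the two systems and the equality holds identically in $u,u_x,u_{xx}$. *)

(* Defs.v *)
From HB Require Import structures.
From mathcomp Require Import all_boot all_order all_algebra.
From mathcomp Require Import all_classical all_reals all_analysis.

Set Implicit Arguments.
Unset Strict Implicit.
Unset Printing Implicit Defensive.

Import Order.TTheory GRing.Theory Num.Theory.
Import numFieldNormedType.Exports.

Local Open Scope classical_set_scope.
Local Open Scope ring_scope.

Definition partial (R : realType) (n : nat) (i : 'I_n)
    (f : 'rV[R]_n -> R) (x : 'rV[R]_n) : R :=
  'D_('e_i) f x.

(* Meant for an open set [U]: all partial derivatives up to order [k] exist and
   are continuous on [U]. *)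
Fixpoint Ck_on (R : realType) (n k : nat) (U : set 'rV[R]_n)
    (f : 'rV[R]_n -> R) {struct k} : Prop :=
  (forall x, U x -> {for x, continuous f}) /\
  match k with
  | 0 => True
  | k'.+1 => forall i : 'I_n,
      (forall x, U x -> derivable f x 'e_i) /\ Ck_on k' U (partial i f)
  end.

Definition smooth_on (R : realType) (n : nat) (U : set 'rV[R]_n)
    (f : 'rV[R]_n -> R) : Prop :=
  forall k : nat, Ck_on k U f.

(* [cmap] and [cinv] are total functions, with no meaning outside of [cdom] and
   of [cmap @` cdom] respectively. *)
Record chart (R : realType) (n : nat) (M : topologicalType) := Chart {
  cdom : set M;
  cmap : M -> 'rV[R]_n;
  cinv : 'rV[R]_n -> M }.

(* The coordinate image of the part of [W] covered by the chart. *)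
Definition coords (R : realType) (n : nat) (M : topologicalType)
    (ch : chart R n M) (W : set M) : set 'rV[R]_n :=
  cmap ch @` (cdom ch `&` W).

Record is_chart (R : realType) (n : nat) (M : topologicalType)
    (ch : chart R n M) : Prop := IsChart {
  chart_open_dom : open (cdom ch);
  chart_open_img : open (coords ch setT);
  chart_cancel : {in cdom ch, cancel (cmap ch) (cinv ch)};
  chart_cmap_continuous : {within cdom ch, continuous (cmap ch)};
  chart_cinv_continuous : {within coords ch setT, continuous (cinv ch)} }.

Definition transition (R : realType) (n : nat) (M : topologicalType)
    (ch ch' : chart R n M) (a : 'I_n) (x : 'rV[R]_n) : R :=
  cmap ch' (cinv ch x) ord0 a.

Definition smooth_transition (R : realType) (n : nat) (M : topologicalType)
    (ch ch' : chart R n M) : Prop :=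
  forall a : 'I_n, smooth_on (coords ch (cdom ch')) (transition ch ch' a).

Definition compatible_charts (R : realType) (n : nat) (M : topologicalType)
    (ch ch' : chart R n M) : Prop :=
  smooth_transition ch ch' /\ smooth_transition ch' ch.

Record smoothManifold (R : realType) (n : nat) := SmoothManifold {
  carrier :> topologicalType;
  carrier_hausdorff : hausdorff_space carrier;
  carrier_second_countable : @second_countable carrier;
  atlas : set (chart R n carrier);
  atlas_chart : forall ch, atlas ch -> is_chart ch;
  atlas_cover : forall m : carrier, exists2 ch, atlas ch & cdom ch m;
  atlas_compatible :
    forall ch ch', atlas ch -> atlas ch' -> compatible_charts ch ch' }.

(* Local coordinates on [M]: the charts of the maximal atlas. *)
Definition local_coordinates (R : realType) (n : nat) (M : smoothManifold R n)
    (ch : chart R n M) : Prop :=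
  is_chart ch /\ forall ch', atlas ch' -> compatible_charts ch ch'.

(* Tensor fields and connections are given by their components in every system
   of local coordinates, subject to the transformation law.  The laws are
   written with the Jacobian of the coordinate change y = y(x) only:
     X'^a = d_i y^a X^i,
     c'^a_{bd} d_j y^b d_k y^d = d_i y^a c^i_{jk},
     Gamma'^a_{bd} d_j y^b d_k y^d + d_j d_k y^a = d_i y^a Gamma^i_{jk}. *)

Record vectorField (R : realType) (n : nat) (M : smoothManifold R n)
    (W : set M) := VectorField {
  vcomp :> chart R n M -> 'I_n -> 'rV[R]_n -> R;
  vcomp_smooth : forall ch, local_coordinates ch ->
    forall i, smooth_on (coords ch W) (vcomp ch i);
  vcomp_transform : forall ch ch', local_coordinates ch ->
    local_coordinates ch' -> forall x, coords ch (cdom ch' `&` W) x ->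
    forall a, vcomp ch' a (cmap ch' (cinv ch x)) =
      \sum_i partial i (transition ch ch' a) x * vcomp ch i x }.

(* [c ch i j k x] is c^i_{jk}(x). *)
Record tensorField12 (R : realType) (n : nat) (M : smoothManifold R n) :=
  TensorField12 {
  tcomp :> chart R n M -> 'I_n -> 'I_n -> 'I_n -> 'rV[R]_n -> R;
  tcomp_smooth : forall ch, local_coordinates ch ->
    forall i j k, smooth_on (coords ch setT) (tcomp ch i j k);
  tcomp_transform : forall ch ch', local_coordinates ch ->
    local_coordinates ch' -> forall x, coords ch (cdom ch') x ->
    forall a j k,
      \sum_b \sum_d tcomp ch' a b d (cmap ch' (cinv ch x)) *
        partial j (transition ch ch' b) x * partial k (transition ch ch' d) x =
      \sum_i partial i (transition ch ch' a) x * tcomp ch i j k x }.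

(* [Gamma ch i j k x] is the Christoffel symbol Gamma^i_{jk}(x), where
   nabla_{d_j} d_k = Gamma^i_{jk} d_i. *)
Record connection (R : realType) (n : nat) (M : smoothManifold R n) :=
  Connection {
  christoffel :> chart R n M -> 'I_n -> 'I_n -> 'I_n -> 'rV[R]_n -> R;
  christoffel_smooth : forall ch, local_coordinates ch ->
    forall i j k, smooth_on (coords ch setT) (christoffel ch i j k);
  christoffel_transform : forall ch ch', local_coordinates ch ->
    local_coordinates ch' -> forall x, coords ch (cdom ch') x ->
    forall a j k,
      \sum_b \sum_d christoffel ch' a b d (cmap ch' (cinv ch x)) *
        partial j (transition ch ch' b) x * partial k (transition ch ch' d) x
        + partial j (partial k (transition ch ch' a)) x =
      \sum_i partial i (transition ch ch' a) x * christoffel ch i j k x }.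

(* T^i_{jk} *)
Definition torsion (R : realType) (n : nat) (M : smoothManifold R n)
    (Gamma : connection M) (ch : chart R n M) (i j k : 'I_n)
    (x : 'rV[R]_n) : R :=
  Gamma ch i j k x - Gamma ch i k j x.

(* The components R^i_{jkl} defined by R(d_k, d_l) d_j = R^i_{jkl} d_i. *)
Definition curvature (R : realType) (n : nat) (M : smoothManifold R n)
    (Gamma : connection M) (ch : chart R n M) (i j k l : 'I_n)
    (x : 'rV[R]_n) : R :=
  partial k (Gamma ch i l j) x - partial l (Gamma ch i k j) x
  + \sum_m Gamma ch i k m x * Gamma ch m l j x
  - \sum_m Gamma ch i l m x * Gamma ch m k j x.

(* nabla_j X^i *)
Definition nablaV (R : realType) (n : nat) (M : smoothManifold R n)
    (Gamma : connection M) (W : set M) (X : vectorField W)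
    (ch : chart R n M) (j i : 'I_n) (x : 'rV[R]_n) : R :=
  partial j (X ch i) x + \sum_k Gamma ch i j k x * X ch k x.

(* nabla_l c^i_{jk} *)
Definition nablaT (R : realType) (n : nat) (M : smoothManifold R n)
    (Gamma : connection M) (c : tensorField12 M)
    (ch : chart R n M) (l i j k : 'I_n) (x : 'rV[R]_n) : R :=
  partial l (c ch i j k) x
  + \sum_m Gamma ch i l m x * c ch m j k x
  - \sum_m Gamma ch m l j x * c ch i m k x
  - \sum_m Gamma ch m l k x * c ch i j m x.

Record flatFManifold (R : realType) (n : nat) := FlatFManifold {
  base :> smoothManifold R n;
  prodF : tensorField12 base;
  connF : connection base;
  prodF_comm : forall ch, local_coordinates ch ->
    forall x, coords ch setT x -> forall i j k,
    prodF ch i j k x = prodF ch i k j x;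
  prodF_assoc : forall ch, local_coordinates ch ->
    forall x, coords ch setT x -> forall i j k l,
    \sum_m prodF ch m j k x * prodF ch i m l x =
    \sum_m prodF ch i j m x * prodF ch m k l x;
  connF_torsionless : forall ch, local_coordinates ch ->
    forall x, coords ch setT x -> forall i j k,
    torsion connF ch i j k x = 0;
  connF_flat : forall ch, local_coordinates ch ->
    forall x, coords ch setT x -> forall i j k l,
    curvature connF ch i j k l x = 0;
  prodF_connF_compatible : forall ch, local_coordinates ch ->
    forall x, coords ch setT x -> forall i j k l,
    nablaT connF prodF ch l i j k x = nablaT connF prodF ch j i l k x }.

Definition flat_field (R : realType) (n : nat) (M : flatFManifold R n)
    (W : set M) (X : vectorField W) : Prop :=
  forall ch, local_coordinates ch -> forall x, coords ch W x ->
  forall i j, nablaV (connF M) X ch j i x = 0.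

(* Flat vector fields on [W] whose values form a basis of every tangent space
   over [W]. *)
Definition flat_basis (R : realType) (n : nat) (M : flatFManifold R n)
    (W : set M) (X : 'I_n -> vectorField W) : Prop :=
  (forall p, flat_field (X p)) /\
  (forall ch, local_coordinates ch -> forall x, coords ch W x ->
     (\matrix_(p < n, i < n) X p ch i x) \in unitmx).

(* nabla_j X^i = c^i_{jk} Y^k *)
Definition recursion (R : realType) (n : nat) (M : flatFManifold R n)
    (W : set M) (X Y : vectorField W) : Prop :=
  forall ch, local_coordinates ch -> forall x, coords ch W x ->
  forall i j,
    nablaV (connF M) X ch j i x = \sum_k prodF M ch i j k x * Y ch k x.

(* The right-hand side V^i_j(u) u^j_x of u^i_t = V^i_j(u) u^j_x. *)
Definition hydro (R : realType) (n : nat)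
    (V : 'I_n -> 'I_n -> 'rV[R]_n -> R) (i : 'I_n) (u ux : 'rV[R]_n) : R :=
  \sum_j V i j u * ux ord0 j.

(* Chain rule for d/dx of a function F(u, u_x). *)
Definition total_x (R : realType) (n : nat) (F : 'rV[R]_n -> 'rV[R]_n -> R)
    (u ux uxx : 'rV[R]_n) : R :=
  \sum_k partial k (F^~ ux) u * ux ord0 k
  + \sum_k partial k (F u) ux * uxx ord0 k.

(* Chain rule for d/dt of a function F(u, u_x) along u^i_t = V^i_j(u) u^j_x,
   with (u^k_x)_t = (u^k_t)_x. *)
Definition total_t (R : realType) (n : nat)
    (V : 'I_n -> 'I_n -> 'rV[R]_n -> R) (F : 'rV[R]_n -> 'rV[R]_n -> R)
    (u ux uxx : 'rV[R]_n) : R :=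
  \sum_k partial k (F^~ ux) u * hydro V k u ux
  + \sum_k partial k (F u) ux * total_x (hydro V k) u ux uxx.

Definition commuting_flows (R : realType) (n : nat) (U : set 'rV[R]_n)
    (V W : 'I_n -> 'I_n -> 'rV[R]_n -> R) : Prop :=
  forall u, U u -> forall (ux uxx : 'rV[R]_n) (i : 'I_n),
    total_t W (hydro V i) u ux uxx = total_t V (hydro W i) u ux uxx.

(* V^i_k = c^i_{jk} X^j *)
Definition principal_system (R : realType) (n : nat) (M : flatFManifold R n)
    (W : set M) (X : vectorField W) (ch : chart R n M)
    (i k : 'I_n) (u : 'rV[R]_n) : R :=
  \sum_j prodF M ch i j k u * X ch j u.

(* Main.v *)
Require Import Defs.
From mathcomp Require Import all_boot all_order all_algebra ring.
From mathcomp Require Import all_classical all_reals all_analysis.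
Import GRing.Theory numFieldNormedType.Exports.
Local Open Scope classical_set_scope.
Local Open Scope ring_scope.

(** Fix a chart and a point u.  Values of vector fields become row vectors; the
product, written x y below, and the Christoffel symbols G become bilinear
operations on them, and so does dc(w; x, y), the derivative of the structure
functions along w.  For the flow of a field X, put v = u_x and z = u_xx: the
chain rule gives u_t = X v, and the velocity of that right-hand side along the
flow of a second field Y is the vector
  dc(Y v; X, v) + DX(Y v) v + X (dc(v; Y, v) + DY(v) v + Y z)
([total_t_hydro]).  Commutation of the two flows says that this vector does not
change when X and Y are exchanged, and this is a purely algebraic fact
([cross_flow_symmetric]).

The recursion gives DX(w) = w xi - G(w, X), where xi is the value of the
previous field of the chain, or 0 when X is flat; likewise DY(w) involves a
vector eta.  Writing C = nabla c, one has
  dc(w; x, y) = C(w, x, y) - G(w, x y) + G(w, x) y + x G(w, y).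
After substitution, G(Y v, X) v and X (G(v, Y) v) cancel, and there remains
  [C(Y v, X, v) + X C(v, Y, v)] - G(Y v, X v) + X G(Y v, v) - X G(v, Y v)
    + X Y G(v, v) + Y v v xi + X v v eta + X Y z.
Since the torsion vanishes, G is symmetric: the two terms X G(Y v, v) cancel,
and all terms outside the bracket are, together, symmetric under the exchange.
By compatibility and commutativity, C is symmetric in its three arguments, so
that the bracket equals C(v, X, Y v) + X C(v, Y, v).  This is the covariant
derivative along v of the trilinear map (x, y, t) |-> x (y t), taken at
(X, Y, v); the map is symmetric in x and y by associativity and commutativity,
hence so is its derivative ([nabla_left_comm]). *)

Set Implicit Arguments.
Unset Strict Implicit.
Unset Printing Implicit Defensive.

(** * Bilinear and trilinear maps given by arrays of coefficients *)

Section Arrays.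
Variables (R : comNzRingType) (n : nat).
Implicit Types (x y z w : 'rV[R]_n) (a b : 'I_n -> 'I_n -> 'I_n -> R)
  (s t : 'I_n -> 'I_n -> 'I_n -> 'I_n -> R).

Definition bil a x y : 'rV[R]_n :=
  \row_i \sum_j \sum_k a i j k * x ord0 j * y ord0 k.

Definition tril t x y z : 'rV[R]_n :=
  \row_i \sum_j \sum_k \sum_l t i j k l * x ord0 j * y ord0 k * z ord0 l.

Lemma eq_bil a b x y : (forall i j k, a i j k = b i j k) ->
  bil a x y = bil b x y.
Proof.
move=> ab; apply/rowP => i; rewrite !mxE.
by apply: eq_bigr => j _; apply: eq_bigr => k _; rewrite ab.
Qed.

Lemma eq_tril s t x y z : (forall i j k l, s i j k l = t i j k l) ->
  tril s x y z = tril t x y z.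
Proof.
move=> st; apply/rowP => i; rewrite !mxE.
by do 3![apply: eq_bigr => ? _]; rewrite st.
Qed.

Lemma bil_flip a x y : bil a x y = bil (fun i j k => a i k j) y x.
Proof.
apply/rowP => i; rewrite !mxE exchange_big; apply: eq_bigr => j _.
by apply: eq_bigr => k _; rewrite mulrAC.
Qed.

Lemma tril_swap t x y z : tril t x y z = tril (fun i j k l => t i k j l) y x z.
Proof.
apply/rowP => i; rewrite !mxE exchange_big; apply: eq_bigr => j _.
by apply: eq_bigr => k _; apply: eq_bigr => l _; congr (_ * _); rewrite mulrAC.
Qed.

Lemma tril_swapr t x y z : tril t x y z = tril (fun i j k l => t i j l k) x z y.
Proof.
apply/rowP => i; rewrite !mxE; apply: eq_bigr => j _; rewrite exchange_big.
by apply: eq_bigr => k _; apply: eq_bigr => l _; rewrite mulrAC.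
Qed.

Lemma trilD s t x y z :
  tril s x y z + tril t x y z =
  tril (fun i j k l => s i j k l + t i j k l) x y z.
Proof.
apply/rowP => i; rewrite !mxE.
by do 3![rewrite -big_split; apply: eq_bigr => ? _]; rewrite /= -!mulrDl.
Qed.

Lemma trilN t x y z : - tril t x y z = tril (fun i j k l => - t i j k l) x y z.
Proof.
apply/rowP => i; rewrite !mxE.
by do 3![rewrite -sumrN; apply: eq_bigr => ? _]; rewrite !mulNr.
Qed.

Lemma bilDl a x y z : bil a (x + y) z = bil a x z + bil a y z.
Proof.
apply/rowP => i; rewrite !mxE -big_split; apply: eq_bigr => j _.
by rewrite -big_split; apply: eq_bigr => k _; rewrite mxE mulrDr mulrDl.
Qed.

Lemma bilNl a x z : bil a (- x) z = - bil a x z.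
Proof.
apply/rowP => i; rewrite !mxE -sumrN; apply: eq_bigr => j _.
by rewrite -sumrN; apply: eq_bigr => k _; rewrite mxE mulrN mulNr.
Qed.

(** This lemma and [bil_bill] reduce identities between nested products of
vectors to identities between arrays of contracted coefficients, which is the
form in which the axioms of an F-manifold are given. *)
Lemma bil_bilr a b x y z :
  bil a x (bil b y z) = tril (fun i j k l => \sum_m a i j m * b m k l) x y z.
Proof.
apply/rowP => i; rewrite !mxE; apply: eq_bigr => j _.
transitivity (\sum_m \sum_k \sum_l
    a i j m * b m k l * x ord0 j * y ord0 k * z ord0 l).
  apply: eq_bigr => m _; rewrite mxE big_distrr; apply: eq_bigr => k _.
  by rewrite big_distrr; apply: eq_bigr => l _ /=; ring.
rewrite exchange_big; apply: eq_bigr => k _; rewrite exchange_big.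
by apply: eq_bigr => l _; rewrite !mulr_suml.
Qed.

Lemma bil_bill a b x y z :
  bil a (bil b x y) z = tril (fun i j k l => \sum_m b m j k * a i m l) x y z.
Proof.
rewrite bil_flip bil_bilr tril_swap tril_swapr; apply: eq_tril => i j k l.
by apply: eq_bigr => m _; rewrite mulrC.
Qed.
End Arrays.

(** * The algebraic identity behind the commutation *)

Section PointwiseIdentity.
Variables (R : comNzRingType) (n : nat).
Let V := 'rV[R]_n.
Variables (mul G : V -> V -> V) (dc C : V -> V -> V -> V).
Hypotheses (mulC : forall x y, mul x y = mul y x)
  (mulCA : forall x y z, mul x (mul y z) = mul y (mul x z))
  (mulDl : forall x y z, mul (x + y) z = mul x z + mul y z)
  (mulNl : forall x z, mul (- x) z = - mul x z)
  (GC : forall x y, G x y = G y x)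
  (dcE : forall w x y,
    dc w x y = C w x y - G w (mul x y) + mul (G w x) y + mul x (G w y))
  (C_sym12 : forall w x y, C w x y = C x w y)
  (C_sym23 : forall w x y, C w x y = C w y x)
  (dc_left_comm : forall w x y z,
    dc w x (mul y z) + mul x (dc w y z) = dc w y (mul x z) + mul y (dc w x z)).

Let mulDr x y z : mul x (y + z) = mul x y + mul x z.
Proof. by rewrite mulC mulDl !(mulC x). Qed.
Let mulNr x y : mul x (- y) = - mul x y.
Proof. by rewrite mulC mulNl (mulC x). Qed.

(** The difference between [dc] and [C] is the action of the operator G(w, _) on
the product as on any tensor, and a map symmetric in two arguments stays
symmetric under that action; hence the ordinary derivative of left-commutativity
can be replaced by the covariant one. *)
Lemma nabla_left_comm w x y z :
  C w x (mul y z) + mul x (C w y z) = C w y (mul x z) + mul y (C w x z).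
Proof.
have := dc_left_comm w x y z; rewrite !dcE !mulDr !mulNr.
rewrite (mulCA x y z) (mulCA x y (G w z)).
rewrite (mulCA (G w x) y z) (mulCA (G w y) x z).
(* All products are now normalized; what is left is additive, and is read off
   entry by entry. *)
move/rowP => h; apply/rowP => i; move: (h i); rewrite !mxE => {}h.
apply: subr0_eq; move/eqP: h; rewrite -subr_eq0 => /eqP <-; ring.
Qed.

(** The vectors [xi] and [eta] stand for the fields that precede [X] and [Y] in
the recursion, [v] and [z] for u_x and u_xx. *)
Lemma cross_flow_symmetric (DX DY : V -> V) (X Y xi eta v z : V) :
    (forall w, DX w = mul w xi - G w X) ->
    (forall w, DY w = mul w eta - G w Y) ->
  dc (mul Y v) X v + mul (DX (mul Y v)) v
    + mul X (dc v Y v + mul (DY v) v + mul Y z) =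
  dc (mul X v) Y v + mul (DY (mul X v)) v
    + mul Y (dc v X v + mul (DX v) v + mul X z).
Proof.
move=> DXE DYE; have h := nabla_left_comm v X Y v.
have C_sym13 w x y : C w x y = C y x w by rewrite C_sym23 C_sym12 C_sym23.
have mulE x y : mul (mul (mul x v) y) v = mul x (mul (mul v y) v).
  rewrite (mulC (mul x v)) (mulCA y) (mulC _ v) mulCA.
  by rewrite (mulC y) (mulC v (mul v y)).
move: h; rewrite !(C_sym13 v _ (mul _ _)).
rewrite !DXE !DYE !dcE !(mulDl, mulDr, mulNl, mulNr) !mulE.
rewrite (GC (mul Y v) (mul X v)) (GC _ v) (GC (mul X v) v) !(mulCA X Y).
move/rowP => h; apply/rowP => i; move: (h i); rewrite !mxE => {}h.
apply: subr0_eq; move/eqP: h; rewrite -subr_eq0 => /eqP <-; ring.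
Qed.
End PointwiseIdentity.

(** * Chain rule for systems of hydrodynamic type *)

Section Partial.
Variables (R : realType) (n : nat).
Implicit Types (f g : 'rV[R]_n -> R) (x u v w : 'rV[R]_n).

Lemma smooth_on_derivable (U : set 'rV[R]_n) f x i :
  smooth_on U f -> U x -> derivable f x 'e_i.
Proof. by move=> /(_ 1%N) [_ /(_ i)[+ _]]; exact. Qed.

Lemma derivable_prod f g x i : derivable f x 'e_i -> derivable g x 'e_i ->
  derivable (fun y => f y * g y) x 'e_i.
Proof. by move=> df dg; exact (derivableM df dg). Qed.

Lemma partial_prod f g x i : derivable f x 'e_i -> derivable g x 'e_i ->
  partial i (fun y => f y * g y) x = partial i f x * g x + f x * partial i g x.
Proof.
move=> df dg; rewrite /partial (deriveM df dg) addrC /GRing.scale /=.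
by rewrite [X in X + _]mulrC.
Qed.

Lemma derivable_bigsum m (F : 'I_m -> 'rV[R]_n -> R) x i :
  (forall j, derivable (F j) x 'e_i) ->
  derivable (fun y => \sum_j F j y) x 'e_i.
Proof.
move=> dF; have <- : \sum_j F j = (fun y => \sum_j F j y) by rewrite fct_sumE.
exact (derivable_sum dF).
Qed.

Lemma partial_bigsum m (F : 'I_m -> 'rV[R]_n -> R) x i :
  (forall j, derivable (F j) x 'e_i) ->
  partial i (fun y => \sum_j F j y) x = \sum_j partial i (F j) x.
Proof.
move=> dF; have <- : \sum_j F j = (fun y => \sum_j F j y) by rewrite fct_sumE.
exact (derive_sum dF).
Qed.

Lemma derivable_coord j x i : derivable (fun y : 'rV[R]_n => y ord0 j) x 'e_i.
Proof. by move/derivable_mxP : (@derivable_id _ _ x 'e_i) => /(_ ord0 j). Qed.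

Lemma partial_coord j x i :
  partial i (fun y : 'rV[R]_n => y ord0 j) x = (j == i)%:R.
Proof.
have := derive_mx (@derivable_id _ _ x 'e_i); rewrite derive_id.
by move/rowP => /(_ j); rewrite /partial !mxE /= => <-.
Qed.

Lemma hydro_velocity (V : 'I_n -> 'I_n -> 'rV[R]_n -> R) i u v k :
  partial k (hydro V i u) v = V i k u.
Proof.
have dcst a : derivable (fun _ : 'rV[R]_n => a : R) v 'e_k.
  by exact (@derivable_cst _ _ _ a v 'e_k).
have dcoord j := @derivable_coord j v k.
rewrite /hydro partial_bigsum => [|j]; last
  exact (derivable_prod (dcst _) (dcoord j)).
rewrite (bigD1 k)//= big1 ?addr0 => [|j jk].
  rewrite (partial_prod (dcst _) (dcoord k)) partial_coord.
  by rewrite /partial derive_cst mul0r add0r eqxx mulr1.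
rewrite (partial_prod (dcst _) (dcoord j)) partial_coord.
by rewrite /partial derive_cst mul0r add0r (negbTE jk) mulr0.
Qed.

Lemma hydro_position (V : 'I_n -> 'I_n -> 'rV[R]_n -> R) i u v k :
  (forall j, derivable (V i j) u 'e_k) ->
  partial k (hydro V i ^~ v) u = \sum_j partial k (V i j) u * v ord0 j.
Proof.
move=> dV; have dcst a : derivable (fun _ : 'rV[R]_n => a : R) u 'e_k.
  by exact (@derivable_cst _ _ _ a u 'e_k).
rewrite /hydro partial_bigsum => [|j]; last
  exact (derivable_prod (dV j) (dcst _)).
apply: eq_bigr => j _; rewrite (partial_prod (dV j) (dcst _)).
by rewrite {2}/partial derive_cst mulr0 addr0.
Qed.

Definition field_value (X : 'I_n -> 'rV[R]_n -> R) u : 'rV[R]_n := \row_i X i u.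
Definition field_deriv w (X : 'I_n -> 'rV[R]_n -> R) u : 'rV[R]_n :=
  \row_i \sum_l w ord0 l * partial l (X i) u.
Definition tensor_deriv w (c : 'I_n -> 'I_n -> 'I_n -> 'rV[R]_n -> R) u i j k :=
  \sum_l w ord0 l * partial l (c i j k) u.

Section System.
Variables (c : 'I_n -> 'I_n -> 'I_n -> 'rV[R]_n -> R)
  (X : 'I_n -> 'rV[R]_n -> R) (u : 'rV[R]_n).
Let V i k u := \sum_j c i j k u * X j u.
Hypotheses (c_diff : forall i j k l, derivable (c i j k) u 'e_l)
  (X_diff : forall j l, derivable (X j) u 'e_l).

Let mul := bil (fun i j k => c i j k u).

Lemma mul_hydroE v i :
  \sum_k V i k u * v ord0 k = mul (field_value X u) v ord0 i.
Proof.
rewrite mxE exchange_big; apply: eq_bigr => k _.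
by rewrite mulr_suml; apply: eq_bigr => j _; rewrite mxE.
Qed.

Lemma derivable_system i k l : derivable (V i k) u 'e_l.
Proof.
apply: derivable_bigsum => j.
exact (derivable_prod (@c_diff i j k l) (@X_diff j l)).
Qed.

(** The left-hand side is the derivative along [w] of the product of X(u) by a
fixed [v]: the two terms are those of the Leibniz rule. *)
Lemma derive_hydro v w i :
  \sum_k partial k (hydro V i ^~ v) u * w ord0 k =
  (bil (tensor_deriv w c u) (field_value X u) v
   + mul (field_deriv w X u) v) ord0 i.
Proof.
under eq_bigr => k _.
  rewrite hydro_position; last by move=> j; exact (@derivable_system i j k).
  under eq_bigr => j _.
    rewrite partial_bigsum; last
      by move=> a; exact (derivable_prod (@c_diff i a j k) (@X_diff a k)).
    under eq_bigr => a _ do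
      rewrite (partial_prod (@c_diff i a j k) (@X_diff a k)).
    over.
  over.
rewrite !mxE -big_split /=.
under eq_bigr => k _ do rewrite mulr_suml.
under eq_bigr => k _ do under eq_bigr => j _ do rewrite !mulr_suml.
rewrite exchange_big; under eq_bigr => j _ do rewrite exchange_big.
rewrite exchange_big; apply: eq_bigr => a _.
rewrite -big_split /=; apply: eq_bigr => j _.
rewrite /tensor_deriv !mxE mulr_sumr !mulr_suml -big_split.
apply: eq_bigr => k _ /=.
by ring.
Qed.

Lemma total_x_hydro v z i :
  total_x (hydro V i) u v z =
  (bil (tensor_deriv v c u) (field_value X u) v + mul (field_deriv v X u) v
   + mul (field_value X u) z) ord0 i.
Proof.
rewrite /total_x derive_hydro [RHS]mxE -mul_hydroE; congr (_ + _).
by apply: eq_bigr => k _; rewrite hydro_velocity.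
Qed.
End System.

Lemma total_t_hydro (c : 'I_n -> 'I_n -> 'I_n -> 'rV[R]_n -> R)
    (X Y : 'I_n -> 'rV[R]_n -> R) u v z i :
  (forall i j k l, derivable (c i j k) u 'e_l) ->
  (forall j l, derivable (X j) u 'e_l) ->
  (forall j l, derivable (Y j) u 'e_l) ->
  let mul := bil (fun i j k => c i j k u) in
  let x := field_value X u in let y := field_value Y u in
  total_t (fun i k u => \sum_j c i j k u * Y j u)
    (hydro (fun i k u => \sum_j c i j k u * X j u) i) u v z =
  (bil (tensor_deriv (mul y v) c u) x v + mul (field_deriv (mul y v) X u) v
   + mul x (bil (tensor_deriv v c u) y v + mul (field_deriv v Y u) v
            + mul y z)) ord0 i.
Proof.
move=> dc dX dY mul x y.
have hydroE k : hydro (fun i k u => \sum_j c i j k u * Y j u) k u v =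
  mul y v ord0 k by exact: mul_hydroE.
rewrite /total_t; under eq_bigr => k _ do rewrite hydroE.
rewrite derive_hydro// [RHS]mxE -mul_hydroE; congr (_ + _).
by apply: eq_bigr => k _; rewrite hydro_velocity total_x_hydro.
Qed.

End Partial.

Lemma partial_eq_on (R : realType) (n : nat) (U : set 'rV[R]_n)
    (f g : 'rV[R]_n -> R) u i :
  open U -> U u -> (forall x, U x -> f x = g x) ->
  partial i f u = partial i g u.
Proof.
move=> oU Uu fg; apply: near_eq_derive.
by near=> y; apply: fg; near: y; exact: open_nbhs_nbhs.
Unshelve. all: by end_near. Qed.

(** * The structure of an F-manifold at a point of a chart *)

Section AtPoint.
Variables (R : realType) (n : nat) (M : flatFManifold R n) (ch : chart R n M).
Hypothesis lch : local_coordinates ch.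
Let U := coords ch setT.
Variable u : 'rV[R]_n.
Hypothesis Uu : U u.
Let c := prodF M ch.
Let Gam := connF M ch.
Let mul := bil (fun i j k => c i j k u).
Let G := bil (fun i j k => Gam i j k u).
Let dc w := bil (tensor_deriv w c u).
(* The first lower index of nabla c, the direction of differentiation, is put
   second in the array so that it is paired with the first vector. *)
Let C w x y :=
  tril (fun i l j k => nablaT (connF M) (prodF M) ch l i j k u) w x y.

Let oU : open U. Proof. exact: chart_open_img (proj1 lch). Qed.

Lemma derivable_c i j k l : derivable (c i j k) u 'e_l.
Proof. exact: smooth_on_derivable (tcomp_smooth _ lch _ _ _) Uu. Qed.

Lemma mulF_comm x y : mul x y = mul y x.
Proof.
rewrite /mul bil_flip; apply: eq_bil => i j k; exact: (prodF_comm lch Uu).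
Qed.

(** Together with commutativity this is equivalent to associativity.  It is a
symmetry between two arguments, so that differentiating it gives
another symmetry between the same two arguments. *)
Lemma prodF_left_comm x : U x -> forall i j k l,
  \sum_m c i j m x * c m k l x = \sum_m c i k m x * c m j l x.
Proof.
move=> Ux i j k l; rewrite /c -!(prodF_assoc lch Ux).
by apply: eq_bigr => m _; rewrite (prodF_comm lch Ux m j k).
Qed.

Lemma mulF_left_comm x y z : mul x (mul y z) = mul y (mul x z).
Proof.
rewrite /mul !bil_bilr [RHS]tril_swap; apply: eq_tril => i j k l.
exact: prodF_left_comm.
Qed.

Lemma conn_sym x y : G x y = G y x.
Proof.
rewrite /G bil_flip; apply: eq_bil => i j k; apply/eqP.
by rewrite -subr_eq0; apply/eqP; exact: (connF_torsionless lch Uu i k j).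
Qed.

Lemma dc_tril w x y :
  dc w x y = tril (fun i l j k => partial l (c i j k) u) w x y.
Proof.
apply/rowP => i; rewrite !mxE [RHS]exchange_big; apply: eq_bigr => j _.
rewrite [RHS]exchange_big; apply: eq_bigr => k _.
rewrite /tensor_deriv !mulr_suml; apply: eq_bigr => l _.
by rewrite [w _ _ * _]mulrC.
Qed.

Lemma dc_comm w x y : dc w x y = dc w y x.
Proof.
rewrite /dc bil_flip; apply: eq_bil => i j k; apply: eq_bigr => l _.
by congr (_ * _); apply: partial_eq_on oU Uu _ => z Uz; exact: (prodF_comm lch).
Qed.

(** Differentiate left-commutativity, which holds on the whole open image of the
chart, at fixed [x], [y], [z]. *)
Lemma dc_left_comm w x y z :
  dc w x (mul y z) + mul x (dc w y z) = dc w y (mul x z) + mul y (dc w x z).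
Proof.
rewrite /dc /mul !bil_bilr !trilD [RHS]tril_swap; apply: eq_tril => i j k l.
have partialE j' k' p : partial p (fun x => \sum_m c i j' m x * c m k' l x) u =
    \sum_m (partial p (c i j' m) u * c m k' l u
            + c i j' m u * partial p (c m k' l) u).
  have dcp a b d := @derivable_c a b d p.
  rewrite partial_bigsum => [|m]; last
    exact (derivable_prod (dcp _ _ _) (dcp _ _ _)).
  by apply: eq_bigr => m _; rewrite (partial_prod (dcp _ _ _) (dcp _ _ _)).
have sumE j' k' : (\sum_m tensor_deriv w c u i j' m * c m k' l u) +
    (\sum_m c i j' m u * tensor_deriv w c u m k' l) =
  \sum_p w ord0 p * partial p (fun x => \sum_m c i j' m x * c m k' l x) u.
  under [RHS]eq_bigr => p _ do rewrite partialE mulr_sumr.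
  rewrite exchange_big -big_split; apply: eq_bigr => m _ /=.
  rewrite mulr_suml mulr_sumr -big_split; apply: eq_bigr => p _ /=.
  by ring.
rewrite !sumE; apply: eq_bigr => p _; congr (_ * _).
by apply: partial_eq_on oU Uu _ => t Ut; exact: prodF_left_comm.
Qed.

Lemma dcE w x y :
  dc w x y = C w x y - G w (mul x y) + mul (G w x) y + mul x (G w y).
Proof.
have -> : C w x y = dc w x y + G w (mul x y) - mul (G w x) y - mul x (G w y).
  rewrite dc_tril /mul /G bil_bill !bil_bilr [X in _ - X]tril_swap.
  rewrite !trilN !trilD.
  apply: eq_tril => i l j k; rewrite /nablaT; congr (_ - _).
  by apply: eq_bigr => m _; rewrite mulrC.
by apply/rowP => i; rewrite !mxE; ring.
Qed.

Lemma nablaC_sym12 w x y : C w x y = C x w y.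
Proof.
rewrite /C tril_swap; apply: eq_tril => i j l k.
exact: prodF_connF_compatible.
Qed.

(** Differentiating commutativity makes [dc] symmetric in its last two arguments,
and the sum of the correction terms in [dcE] is symmetric in them as well. *)
Lemma nablaC_sym23 w x y : C w x y = C w y x.
Proof.
have CE z t : C w z t =
    dc w z t + G w (mul z t) - mul (G w z) t - mul z (G w t).
  by rewrite dcE; apply/rowP => i; rewrite !mxE; ring.
rewrite !CE dc_comm (mulF_comm y x) (mulF_comm (G w y)) (mulF_comm y).
by rewrite addrAC.
Qed.

Lemma field_derivE (W : set M) (X : vectorField W) (xi : 'rV[R]_n) :
    (forall i j, nablaV (connF M) X ch j i u = \sum_k c i j k u * xi ord0 k) ->
  forall w, field_deriv w (X ch) u = mul w xi - G w (field_value (X ch) u).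
Proof.
move=> nX w; apply/rowP => i; rewrite !mxE -sumrB; apply: eq_bigr => l _.
have -> : partial l (X ch i) u =
    \sum_k c i l k u * xi ord0 k - \sum_k Gam i l k u * X ch k u.
  by rewrite -nX /nablaV addrK.
rewrite mulrBr !mulr_sumr; congr (_ - _); apply: eq_bigr => k _; first ring.
by rewrite mxE; ring.
Qed.

(** The hypotheses on [X] and [Y] constrain their covariant derivatives at the
single point [u], so that a flat field and a field given by the recursion are
treated alike. *)
Lemma commuting_at (W : set M) (X Y : vectorField W) (xi eta v z : 'rV[R]_n) i :
    coords ch W u ->
    (forall i j, nablaV (connF M) X ch j i u = \sum_k c i j k u * xi ord0 k) ->
    (forall i j, nablaV (connF M) Y ch j i u = \sum_k c i j k u * eta ord0 k) ->
  total_t (principal_system Y ch) (hydro (principal_system X ch) i) u v z =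
  total_t (principal_system X ch) (hydro (principal_system Y ch) i) u v z.
Proof.
move=> Wu nX nY.
have dX (Z : vectorField W) j l : derivable (Z ch j) u 'e_l.
  exact: smooth_on_derivable (vcomp_smooth Z lch j) Wu.
have dcu := derivable_c.
rewrite /principal_system !(total_t_hydro _ _ _ dcu (dX _) (dX _)).
congr (fun_of_matrix _ ord0 i).
have mulDl x y t : mul (x + y) t = mul x t + mul y t by exact: bilDl.
have mulNl x t : mul (- x) t = - mul x t by exact: bilNl.
exact (cross_flow_symmetric mulF_comm mulF_left_comm mulDl mulNl conn_sym dcE
  nablaC_sym12 nablaC_sym23 dc_left_comm v z
  (field_derivE nX) (field_derivE nY)).
Qed.
End AtPoint.

Unset Implicit Arguments.

Theorem theorem12 (R : realType) (n : nat) (M : flatFManifold R n)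
    (W : set M) (oW : open W)
    (X : 'I_n -> nat -> vectorField W)
    (X0 : flat_basis (fun p : 'I_n => X p 0%N))
    (Xrec : forall (p : 'I_n) (alpha : nat),
      recursion (X p alpha.+1) (X p alpha)) :
  forall ch : chart R n M, local_coordinates ch ->
  forall (p q : 'I_n) (alpha beta : nat),
    commuting_flows (coords ch W)
      (principal_system (X p alpha) ch) (principal_system (X q beta) ch).
Proof.
move=> ch lch p q alpha beta u Wu ux uxx i.
have Uu : coords ch setT u by case: Wu => m [chm _] <-; exists m.
have nablaX r a : exists xi : 'rV[R]_n, forall i j,
    nablaV (connF M) (X r a) ch j i u = \sum_k prodF M ch i j k u * xi ord0 k.
  (* A flat field is preceded by the zero vector. *)
  case: a => [|a].
    exists 0 => k j; rewrite (X0.1 r _ lch _ Wu) big1// => l _.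
    by rewrite mxE mulr0.
  exists (field_value (X r a ch) u) => k j; rewrite (Xrec r a _ lch _ Wu).
  by apply: eq_bigr => l _; rewrite mxE.
have [xi nX] := nablaX p alpha; have [eta nY] := nablaX q beta.
exact (commuting_at lch Uu ux uxx i Wu nX nY).
Qed.
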